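(* Let $X$ be a pseudocompact space which is selection pointwise-maximal. Then for every $p\in X$ there exists a $p$-maximal continuous selection $f:\mathscr{F}(\beta X)\to\beta X$ for the hyperspace $\mathscr{F}(\beta X)$ of the Čech–Stone compactification $\beta X$ of $X$.
   Context: All spaces are Hausdorff topological spaces; pseudocompact means Tychonoff with every continuous real-valued function bounded. $X$ is regarded as a subspace of $\beta X$. For a space $Z$, $\mathscr{F}(Z)$ is the set of all nonempty closed subsets of $Z$, endowed with the Vietoris topology, generated by all collections $\langle V_1,\dots,V_n\rangle=\{S\in\mathscr{F}(Z): S\subset\bigcup_i V_i\text{ and }S\cap V_i\ne\emptyset\text{ for every }i\}$, where $V_1,\dots,V_n$ is a finite family of open subsets of $Z$. A continuous selection for $\mathscr{F}(Z)$ is a Vietoris continuous map $f:\mathscr{F}(Z)\to Z$ with $f(S)\in S$ for every $S\in\mathscr{F}(Z)$. For $p\in Z$, a continuous selection $f$ for $\mathscr{F}(Z)$ is $p$-maximal if $f(S)=p$ for every $S\in\mathscr{F}(Z)$ with $p\in S$. A space $X$ is selection pointwise-maximal if for each $p\in X$ there exists a $p$-maximal continuous selection for $\mathscr{F}(X)$. *)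

(* Defs.v *)
From HB Require Import structures.
From mathcomp Require Import all_boot all_order all_algebra.
From mathcomp Require Import finmap.
From mathcomp Require Import all_classical all_reals.
From mathcomp Require Import topology normedtype.

Set Implicit Arguments.
Unset Strict Implicit.
Unset Printing Implicit Defensive.

Import Order.TTheory GRing.Theory Num.Theory.
Import numFieldNormedType.Exports.

Local Open Scope classical_set_scope.
Local Open Scope ring_scope.

Record hyperspace (Z : topologicalType) := Hyperspace {
  hset :> set Z;
  hset_closed : closed hset;
  hset_neq0 : hset !=set0 }.

HB.instance Definition _ (Z : topologicalType) := gen_eqMixin (hyperspace Z).
HB.instance Definition _ (Z : topologicalType) :=
  gen_choiceMixin (hyperspace Z).

(* The set written <V_1, ..., V_n> in the literature. It is empty for n = 0,
   because the points of the hyperspace are nonempty sets. *)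
Definition vietoris_basic (Z : topologicalType) (n : nat)
    (V : 'I_n -> set Z) : set (hyperspace Z) :=
  [set S : hyperspace Z |
    hset S `<=` \bigcup_i V i /\ forall i, hset S `&` V i !=set0].

Definition vietoris_subbase (Z : topologicalType) :
    set (set (hyperspace Z)) :=
  [set B | exists (n : nat) (V : 'I_n -> set Z),
    (forall i, open (V i)) /\ B = vietoris_basic V].

HB.instance Definition _ (Z : topologicalType) :=
  isSubBaseTopological.Build (hyperspace Z) (@vietoris_subbase Z) id.

Lemma vietoris_basic_open (Z : topologicalType) (n : nat)
    (V : 'I_n -> set Z) : (forall i, open (V i)) -> open (vietoris_basic V).
Proof.
move=> oV; exists [set vietoris_basic V]; last by rewrite bigcup_set1.
move=> _ ->; exists [fset vietoris_basic V]%fset.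
  by move=> B /fset1P ->; apply/mem_set; exists n, V.
by rewrite set_fset1 bigcap_set1.
Qed.

Definition continuous_selection (Z : topologicalType)
    (f : hyperspace Z -> Z) : Prop :=
  continuous f /\ forall S : hyperspace Z, hset S (f S).

Definition maximal_selection (Z : topologicalType) (p : Z)
    (f : hyperspace Z -> Z) : Prop :=
  continuous_selection f /\ forall S : hyperspace Z, hset S p -> f S = p.

Definition selection_pointwise_maximal (Z : topologicalType) : Prop :=
  forall p : Z, exists f : hyperspace Z -> Z, maximal_selection p f.

Definition tychonoff_space (X : topologicalType) : Prop :=
  hausdorff_space X /\ completely_regular_space X.

Definition pseudocompact (R : realType) (X : topologicalType) : Prop :=
  tychonoff_space X /\
  forall f : X -> R, continuous f -> exists M : R, forall x, `|f x| <= M.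

(* The Cech-Stone compactification is realized as the closure of the image of
   X in the cube [0,1]^C(X,[0,1]), the cube being itself seen as a (closed)
   subset of the product of copies of R. *)
Section stone_cech.
Context (R : realType) (X : topologicalType).

Definition cube_index : Type :=
  set_type [set g : X -> R | continuous g /\ range g `<=` `[0, 1]].

Definition cube_eval (x : X) : prod_topology (fun _ : cube_index => R) :=
  fun g => set_val g x.

Definition stone_cech : topologicalType :=
  set_type (closure (range cube_eval)).

Lemma cube_eval_closure x : cube_eval x \in closure (range cube_eval).
Proof. by apply/mem_set/subset_closure; exists x. Qed.

Definition stone_cech_in (x : X) : stone_cech :=
  exist _ (cube_eval x) (cube_eval_closure x).

Lemma cube_indexP (g : cube_index) :
  continuous (set_val g : X -> R) /\ range (set_val g : X -> R) `<=` `[0, 1].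
Proof. by case: g => g gP; exact: (set_mem gP). Qed.

Lemma stone_cech_val_continuous :
  continuous (set_val : stone_cech -> prod_topology (fun _ : cube_index => R)).
Proof. exact: initial_continuous. Qed.

Lemma cube_eval_continuous : continuous cube_eval.
Proof.
move=> x; apply/cvg_sup => g; move: x.
apply: (@continuous_comp_initial (prod_topology (fun _ : cube_index => R)) X R
  (fun u => u g) cube_eval) => x.
by have [+ _] := cube_indexP g; apply.
Qed.

Lemma cube_proj_continuous (g : cube_index) :
  continuous (fun z : stone_cech => (set_val z : _ -> R) g).
Proof.
move=> z.
have := @continuous_comp stone_cech (prod_topology (fun _ : cube_index => R)) R
  set_val (@proj cube_index (fun=> R) g) z.
apply; first exact: stone_cech_val_continuous.
exact: (@proj_continuous cube_index (fun=> R)).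
Qed.

Lemma stone_cech_in_continuous : continuous stone_cech_in.
Proof.
apply: (@continuous_comp_initial stone_cech X _ set_val).
exact: cube_eval_continuous.
Qed.

Lemma stone_cech_in_dense : dense (range stone_cech_in).
Proof.
move=> O [z Oz] [W oW WO].
have clz : closure (range cube_eval) (set_val z) by exact: set_valP.
have [|y [[x _ <-] Wx]] := clz W.
  by apply: open_nbhs_nbhs; split=> //; rewrite -WO in Oz.
by exists (stone_cech_in x); split; [rewrite -WO|exists x].
Qed.

Lemma cube_hausdorff :
  hausdorff_space (prod_topology (fun _ : cube_index => R)).
Proof. by apply: hausdorff_product => g; exact: Rhausdorff. Qed.

Lemma stone_cech_hausdorff : hausdorff_space stone_cech.
Proof.
move=> p q pq; apply/val_inj/cube_hausdorff => A B nA nB.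
have [z [Az Bz]] := pq _ _ (stone_cech_val_continuous nA)
  (stone_cech_val_continuous nB).
by exists (set_val z).
Qed.

Lemma stone_cech_compact : compact [set: stone_cech].
Proof.
pose P := prod_topology (fun _ : cube_index => R).
pose C : set P := [set u | forall g, `[0, 1]%classic (u g)].
have cC : compact C.
  apply: (@tychonoff cube_index (fun=> R) (fun=> `[0, 1]%classic)) => g.
  exact: segment_compact.
have sC : closure (range cube_eval : set P) `<=` C.
  rewrite closureE; apply: smallest_sub; first exact: compact_closed cube_hausdorff cC.
  by move=> _ [x _ <-] g; have [_] := cube_indexP g; apply; exists x.
have cA := subclosed_compact (@closed_closure P (range cube_eval)) cC sC.
move=> F PF _.
have [] := cA (set_val @ F) _.
  by apply: (@filterS _ F _ setT) => [z _|]; [exact: set_valP|exact: filterT].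
move=> u [Au cu]; exists (exist _ u (mem_set Au)); split=> // S V FS.
rewrite nbhsE /= => -[_ [[W oW <-] Wu] WV].
have [||_ [[z Sz <-] Wz]] := cu (set_val @` S) W.
- by apply: (@filterS _ F _ S) => // z Sz; exists z.
- exact: open_nbhs_nbhs.
- by exists z; split=> //; exact: WV.
Qed.

Lemma tychonoff_cubeP (B : set X) x : tychonoff_space X ->
  closed B -> ~ B x -> exists g : cube_index,
    set_val g x = 0 /\ forall y, B y -> set_val g y = 1.
Proof.
move=> [_ crX] cB Bx; have /(@uniform_separatorP _ R) := crX _ _ cB Bx.
case=> g [cg g01 gx gB].
have gP : g \in [set g : X -> R | continuous g /\ range g `<=` `[0, 1]].
  exact/mem_set.
exists (exist _ g gP); split; first by apply: gx; exists x.
by move=> y By; apply: gB; exists y.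
Qed.

Lemma stone_cech_in_inj : tychonoff_space X -> injective stone_cech_in.
Proof.
move=> tX x y xy; apply: contrapT => nxy.
have cly : closed [set y].
  by apply/accessible_closed_set1/hausdorff_accessible; case: tX.
have [g [gx gy]] := tychonoff_cubeP tX cly nxy.
have : (set_val g : X -> R) x = set_val g y.
  by rewrite -[LHS]/(set_val (stone_cech_in x) g) xy.
by rewrite gx gy // => /esym/eqP; rewrite oner_eq0.
Qed.

Lemma stone_cech_in_open (U : set X) : tychonoff_space X -> open U ->
  exists2 V : set stone_cech, open V & stone_cech_in @^-1` V = U.
Proof.
move=> tX oU.
pose V (g : cube_index) :=
  (fun z : stone_cech => (set_val z : _ -> R) g) @^-1` [set r | r < 1].
pose D := [set g : cube_index | forall y, ~ U y -> set_val g y = 1].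
exists (\bigcup_(g in D) V g).
  apply: bigcup_open => g _; apply: open_comp; last exact: open_lt.
  by move=> z _; exact: cube_proj_continuous.
rewrite eqEsubset; split=> [x [g Dg Vx]|x Ux].
  apply: contrapT => /Dg gx.
  by move: (Vx : (set_val g : X -> R) x < 1); rewrite gx ltxx.
have [|g [gx gU]] := tychonoff_cubeP tX (open_closedC oU) (x := x).
  exact.
exists g => //; have : (set_val g : X -> R) x < 1 by rewrite gx.
exact.
Qed.

Lemma stone_cech_extension (g : X -> R) (M : R) :
  continuous g -> (forall x, `|g x| <= M) ->
  exists2 h : stone_cech -> R,
    continuous h & forall x, h (stone_cech_in x) = g x.
Proof.
move=> cg gM; pose c := 1 + `|M|; pose k x := (g x + c) / (c + c).
have c0 : 0 < c by rewrite ltr_pwDl.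
have cc0 : 0 < c + c by rewrite addr_gt0.
have gc x : `|g x| <= c.
  by rewrite (le_trans (gM x)) // (le_trans (ler_norm _)) // lerDr.
have kP : k \in [set g : X -> R | continuous g /\ range g `<=` `[0, 1]].
  apply/mem_set; split.
    move=> x; apply: cvgMr_tmp; apply: cvgD; [exact: cg|exact: cvg_cst].
  move=> _ [x _ <-]; have := gc x; rewrite ler_norml => /andP[cx xc].
  rewrite /= in_itv /= /k ler_pdivlMr // ler_pdivrMr // mul0r mul1r lerD2r xc.
  by rewrite -lerBlDr sub0r cx.
pose affine (r : R) := r * (c + c) - c.
have affine_continuous : continuous affine.
  by move=> r; apply: cvgB; [apply: cvgMr_tmp; exact: cvg_id|exact: cvg_cst].
exists (fun z => affine ((set_val z : _ -> R) (exist _ k kP))).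
  move=> z; have := @continuous_comp stone_cech R R
    (fun z => (set_val z : _ -> R) (exist _ k kP)) affine z.
  by apply; [exact: cube_proj_continuous|exact: affine_continuous].
move=> x; have : k x * (c + c) - c = g x.
  by rewrite /k divfK ?gt_eqF // addrK.
exact.
Qed.

End stone_cech.
Arguments stone_cech_in R {X} x.

(* Main.v *)
Require Import Defs.
From mathcomp Require Import all_boot all_order all_algebra.
From mathcomp Require Import finmap.
From mathcomp Require Import all_classical all_reals.
From mathcomp Require Import topology normedtype.
From mathcomp Require Import ring lra.

(* The first step is that X is countably compact. If f is y-maximal, the C_k are
   closed sets missing y whose union accumulates at y, and E_k is the union of
   the first k of them, then f(E_k u {z}) = z for all z in a neighbourhood B_k
   of y, and letting k tend to infinity shows that the B_k meet only in y; by
   pseudocompactness y is then a point of first countability. Hence every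
   sequence of nonempty open sets has a subsequence with a convergent choice of
   points, and so does every sequence of products of two open sets. With this, a
   sequence without cluster points contradicts the continuity of the relation
   "f {u, v} = u".

   A countably compact space with such a relation has compact closures of
   countable sets, so every sequence in F(X) converges along every ultrafilter
   on the natural numbers.

   Finally, in the spirit of Glicksberg and Ginsburg, for g continuous on X the
   function phi = g o f on F(X) is controlled by the continuous pseudometric
   rho(x, y) = sup_K |phi({x} u K) - phi({y} u K)| on X: sets at small Hausdorff
   rho-distance have close phi-values. As rho is totally bounded and the
   functions rho(a, .) extend to beta X, f has a limit along the traces on F(X)
   of the neighbourhoods of any S in F(beta X). These limits form the selection;
   it is p-maximal because the traces contain sets through p when p is in S. *)

Set Implicit Arguments.
Unset Strict Implicit.
Unset Printing Implicit Defensive.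

Import Order.TTheory GRing.Theory Num.Theory.
Import numFieldNormedType.Exports.

Local Open Scope classical_set_scope.
Local Open Scope ring_scope.

(** * The Vietoris topology *)

Section hyperspace_topology.
Context {X : topologicalType}.
Implicit Types (S T K : hyperspace X) (V : set X).

Lemma hyper_eq S T : hset S = hset T -> S = T.
Proof.
case: S T => [A cA A0] [B cB B0] /= AB; move: cB B0; rewrite -AB => cB B0.
by rewrite (Prop_irrelevance cA cB) (Prop_irrelevance A0 B0).
Qed.

Lemma open_hyper_sub V : open V -> open [set S : hyperspace X | hset S `<=` V].
Proof.
move=> oV; have := @vietoris_basic_open X 1 (fun=> V) (fun=> oV).
congr open; apply/seteqP; split=> S /=.
  by move=> [SV _] x /SV [].
move=> SV; split=> [x /SV Vx|_]; first by exists ord0.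
by have [x Sx] := hset_neq0 S; exists x; split=> //; exact: SV.
Qed.

Lemma open_hyper_meet V :
  open V -> open [set S : hyperspace X | hset S `&` V !=set0].
Proof.
move=> oV.
have := @vietoris_basic_open X 2 (fun i => if i == ord0 then V else setT).
have oT (i : 'I_2) : open (if i == ord0 then V else setT).
  by case: ifP => // _; exact: openT.
move=> /(_ oT); congr open; apply/seteqP; split=> S /=.
  by move=> [_ /(_ ord0)].
move=> SV; split=> [x Sx|i]; first by exists ord_max.
case: ifP => // _; have [x Sx] := hset_neq0 S; by exists x.
Qed.

(** A basic set <V_1, ..., V_n> is cut out by one upper condition, being contained in the union, and
    n lower ones, meeting each V_i, so testing these two kinds of sets suffices. *)
Lemma hyper_cvg (I : Type) (F : set_system I) (T : I -> hyperspace X) S :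
  Filter F ->
  (forall V, open V -> hset S `<=` V -> \forall i \near F, hset (T i) `<=` V) ->
  (forall V, open V -> hset S `&` V !=set0 ->
    \forall i \near F, hset (T i) `&` V !=set0) ->
  T @ F --> S.
Proof.
move=> FF up low A; rewrite nbhsE => -[B [[C sC <-] [D CD DS]] sBA].
rewrite nbhs_filterE; apply: filterS sBA _; apply: (@filterS _ _ _ D).
  by move=> ? ?; exists D.
have /sC [E sE EID] := CD; rewrite -EID; apply: filter_bigI => W EW.
have : W S by move: DS; rewrite -EID => /(_ _ EW).
have /sE := EW; rewrite inE => -[n [U [oU ->]]] [SU SUi].
apply: filterI; first by apply: up => //; exact: bigcup_open.
by apply: filter_forall => i; exact: low.
Qed.

Lemma hyperU_subproof S T :
  closed (hset S `|` hset T) /\ (hset S `|` hset T) !=set0.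
Proof.
split; first by apply: closedU; exact: hset_closed.
by have [x Sx] := hset_neq0 S; exists x; left.
Qed.

Definition hyperU S T : hyperspace X :=
  Hyperspace (hyperU_subproof S T).1 (hyperU_subproof S T).2.

Lemma hyperUC S T : hyperU S T = hyperU T S.
Proof. by apply: hyper_eq; rewrite /= setUC. Qed.

Lemma hyperUidl S T : hset S `<=` hset T -> hyperU S T = T.
Proof. by move=> ST; apply: hyper_eq; rewrite /= setUidr. Qed.

Lemma cvg_hyper_sub (I : Type) (F : set_system I) (T : I -> hyperspace X) S V :
  Filter F -> T @ F --> S -> open V -> hset S `<=` V ->
  \forall i \near F, hset (T i) `<=` V.
Proof.
move=> FF TS oV SV; apply: (TS [set S | hset S `<=` V]).
by apply: open_nbhs_nbhs; split=> //; exact: open_hyper_sub.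
Qed.

Lemma cvg_hyper_meet (I : Type) (F : set_system I) (T : I -> hyperspace X) S V :
  Filter F -> T @ F --> S -> open V -> hset S `&` V !=set0 ->
  \forall i \near F, hset (T i) `&` V !=set0.
Proof.
move=> FF TS oV SV; apply: (TS [set S | hset S `&` V !=set0]).
by apply: open_nbhs_nbhs; split=> //; exact: open_hyper_meet.
Qed.

Lemma cvg_hyperU (I : Type) (F : set_system I) (S T : I -> hyperspace X) A B :
  Filter F -> S @ F --> A -> T @ F --> B ->
  (fun i => hyperU (S i) (T i)) @ F --> hyperU A B.
Proof.
move=> FF SA TB; apply: hyper_cvg => V oV /=.
  rewrite subUset => -[AV BV]; near=> i; rewrite subUset; split; near: i.
    exact: cvg_hyper_sub SA oV AV.
  exact: cvg_hyper_sub TB oV BV.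
rewrite setIUl => -[x [ABx|ABx]].
  have : \forall i \near F, hset (S i) `&` V !=set0.
    by apply: cvg_hyper_meet SA oV _; exists x.
  by apply: filterS => i [y [Sy Vy]]; exists y; split=> //; left.
have : \forall i \near F, hset (T i) `&` V !=set0.
  by apply: cvg_hyper_meet TB oV _; exists x.
by apply: filterS => i [y [Sy Vy]]; exists y; split=> //; right.
Unshelve. all: by end_near. Qed.

Lemma cvg_hyper_increasing (E : nat -> hyperspace X) S :
  (forall m n, (m <= n)%N -> hset (E m) `<=` hset (E n)) ->
  hset S = closure (\bigcup_n hset (E n)) -> E @ \oo --> S.
Proof.
move=> mE SE; apply: hyper_cvg => V oV.
  move=> SV; apply: filterE => n x Ex; apply: SV; rewrite SE.
  by apply: subset_closure; exists n.
rewrite SE => -[x [+ Vx]] => /(_ V (open_nbhs_nbhs (conj oV Vx))).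
move=> [y [[n _ Eny] Vy]]; exists n => // m /= nm.
by exists y; split=> //; exact: mE nm _ Eny.
Qed.

(** Supersets of [S] inherit all its lower conditions, so the filter generated by the supersets of
    [S] inside open sets [V] converges to [S]. *)
Lemma hyper_upper_nbhs S (W : set (hyperspace X)) : nbhs S W ->
  exists V, [/\ open V, hset S `<=` V &
    forall T, hset S `<=` hset T -> hset T `<=` V -> W T].
Proof.
pose F := filter_from [set V : set X | open V /\ hset S `<=` V]
  (fun V => [set T : hyperspace X | hset S `<=` hset T /\ hset T `<=` V]).
have FF : Filter F.
  apply: filter_from_filter; first by exists setT; split=> //; exact: openT.
  move=> U V [oU SU] [oV SV]; exists (U `&` V).
    by split; [exact: openI|move=> z Sz; split; [exact: SU|exact: SV]].
  by move=> T [ST TUV]; split; split=> // z /TUV[].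
have FS : id @ F --> S.
  apply: hyper_cvg => V oV SV; first by exists V => // T [].
  exists setT; first by split=> //; exact: openT.
  by move=> T [ST _]; have [z [Sz Vz]] := SV; exists z; split=> //; exact: ST.
move=> /FS[V [oV SV] VW]; exists V; split=> // T ST TV.
by apply: VW.
Qed.

Hypothesis hX : hausdorff_space X.

Lemma closed_point (x : X) : closed [set x].
Proof. exact/accessible_closed_set1/hausdorff_accessible. Qed.

Definition hyper1 (x : X) : hyperspace X :=
  Hyperspace (@closed_point x) (ex_intro _ x erefl).

Lemma cvg_hyper1 (I : Type) (F : set_system I) (y : I -> X) x :
  Filter F -> y @ F --> x -> (fun i => hyper1 (y i)) @ F --> hyper1 x.
Proof.
move=> FF yx; apply: hyper_cvg => V oV /=.
  move=> xV; have : \forall i \near F, V (y i).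
    by apply: yx; apply: open_nbhs_nbhs; split=> //; exact: xV.
  by apply: filterS => i Vi _ ->.
move=> [_ [-> Vx]]; have : \forall i \near F, V (y i).
  by apply: yx; exact: open_nbhs_nbhs.
by apply: filterS => i Vi; exists (y i).
Qed.

Lemma closed_finite (A : set X) : finite_set A -> closed A.
Proof.
by have /accessible_finite_set_closed := hausdorff_accessible hX; apply.
Qed.

(** One point of [S] in each of the finitely many [V i] settles the lower conditions, and subsets of
    [S] inherit the upper ones. *)
Lemma finite_hyper_dense S (W : set (hyperspace X)) : nbhs S W ->
  exists T, [/\ W T, finite_set (hset T) & hset T `<=` hset S].
Proof.
rewrite nbhsE => -[B [[C sC <-] [D CD DS]] sBA].
suff [T [DT fT TS]] : exists T,
    [/\ D T, finite_set (hset T) & hset T `<=` hset S].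
  by exists T; split=> //; apply: sBA; exists D.
have /sC [E sE EID] := CD.
have pE (U : set (hyperspace X)) : exists A : set X, [/\ finite_set A,
    A `<=` hset S & (U \in E ->
      forall T, A `<=` hset T -> hset T `<=` hset S -> U T)].
  have [UE|UE] := boolP (U \in E); last first.
    by exists set0; split=> // /(negP UE).
  have /sE := UE; rewrite inE => -[n [V [oV UV]]].
  have : U S by move: DS; rewrite -EID => /(_ U UE).
  rewrite UV => -[SV SVi].
  have [s sP] := choice SVi; exists (range s); split.
  - exact/finite_image/finite_finset.
  - by move=> _ [i _ <-]; have [] := sP i.
  - move=> _ T sT TS; split=> [x /TS/SV //|i].
    by exists (s i); split; [apply: sT; exists i|have [] := sP i].
have [A AP] := choice pE.
(* [x] keeps the finite set nonempty even when [E] is empty. *)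
have [x Sx] := hset_neq0 S.
pose K := x |` \bigcup_(U in [set` E]) A U.
have fK : finite_set K.
  rewrite finite_setU; split=> //; apply: bigcup_finite => // U _.
  by have [] := AP U.
have KS : K `<=` hset S.
  by move=> y [->//|[U _]]; have [_ + _] := AP U; apply.
have K0 : K !=set0 by exists x; left.
exists (Hyperspace (closed_finite fK) K0); split=> //.
rewrite -EID => U EU; have [_ _ /(_ EU)] := AP U; apply=> //= y Ay.
by right; exists U.
Qed.

End hyperspace_topology.

(** * Pseudocompactness and weak selections *)

(** This negates local finiteness at [y] of the indexed family: a set repeated infinitely often
    counts each time. *)
Definition frequently_meets {X : topologicalType} (U : nat -> set X) (y : X) :=
  forall W, nbhs y W -> forall n, exists2 m, (n <= m)%N & U m `&` W !=set0.

Definition feebly_compact (X : topologicalType) :=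
  forall U : nat -> set X, (forall n, open (U n)) -> (forall n, U n !=set0) ->
  exists y, frequently_meets U y.

(* If the [U n] were locally finite, the sum of [n] times a bump function
   supported in [U n] would be continuous and unbounded. *)
Lemma pseudocompact_feebly_compact (R : realType) (X : topologicalType) :
  pseudocompact R X -> feebly_compact X.
Proof.
move=> [tX pX] U oU U0; apply: contrapT => noy.
have locfin (y : X) : exists2 W, nbhs y W & exists n, forall m, (n <= m)%N ->
    forall z, W z -> ~ U m z.
  apply: contrapT => h; apply: noy; exists y => W yW n.
  apply: contrapT => hn; apply: h; exists W => //; exists n => m nm z Wz Uz.
  by apply: hn; exists m => //; exists z.
have [x Ux] := choice U0.
have bump (n : nat) : exists g : X -> R, [/\ continuous g, forall z, 0 <= g z,
    g (x n) = 1 & forall z, ~ U n z -> g z = 0].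
  have [|g [gx gU]] := tychonoff_cubeP R tX (open_closedC (oU n)) (x := x n).
    by apply; exact: Ux.
  have [cg g01] := cube_indexP g.
  exists (fun z => 1 - set_val g z); split=> [z|z||z nUz].
  - by apply: cvgB; [exact: cvg_cst|exact: cg].
  - have /g01 : range (set_val g) (set_val g z) by exists z.
    by rewrite /= in_itv /= subr_ge0 => /andP[].
  - by rewrite gx subr0.
  - by rewrite gU // subrr.
have [g gP] := choice bump.
have Nex (y : X) : exists n, forall m, (n <= m)%N -> ~ U m y.
  have [W yW [n nP]] := locfin y; exists n => m nm.
  by apply: nP => //; exact: nbhs_singleton.
have [N NP] := choice Nex.
pose t m z := m%:R * g m z.
(* The cutoff [N z] may vary wildly with [z]; [hE] trades it for any bound beyond which no [U m]
   contains [z], in particular for a locally constant one. *)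
pose h z := \sum_(0 <= m < N z) t m z.
have hE z n : (forall m, (n <= m)%N -> ~ U m z) -> h z = \sum_(0 <= m < n) t m z.
  have key a b : (a <= b)%N -> (forall m, (a <= m)%N -> ~ U m z) ->
      \sum_(0 <= m < b) t m z = \sum_(0 <= m < a) t m z.
    move=> ab aU; rewrite (big_cat_nat _ ab) //=.
    suff -> : \sum_(a <= m < b) t m z = 0 by rewrite addr0.
    rewrite big_nat_cond big1 // => m /andP[/andP[am _] _].
    by have [_ _ _ gU] := gP m; rewrite /t gU ?mulr0 //; exact: aU.
  move=> nU; rewrite /h; have [Nn|/ltnW nN] := leqP (N z) n.
    by rewrite -(key _ _ Nn) //; exact: NP.
  exact: key.
have ch : continuous h.
  move=> y; have [W yW [n nP]] := locfin y.
  have : (fun z => \sum_(0 <= m < n) t m z) @ y --> \sum_(0 <= m < n) t m y.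
    apply: cvg_big => [|m _]; first exact: add_continuous.
    apply: cvgM; first exact: cvg_cst.
    by have [cg _ _ _] := gP m; exact: cg.
  have <- := hE y n (fun m nm => nP m nm _ (nbhs_singleton yW)).
  apply: cvg_trans; apply: near_eq_cvg; apply: filterS yW => z Wz.
  by apply/esym/hE => m nm; exact: nP nm _ Wz.
have [M hM] := pX h ch.
pose m := Num.bound `|M|.
have Mm : M < m%:R by apply: le_lt_trans (ler_norm _) _; exact: archi_boundP.
have mN : (m < N (x m))%N.
  by rewrite ltnNge; apply/negP => /NP; apply; exact: Ux.
have tm : t m (x m) = m%:R by rewrite /t; have [_ _ -> _] := gP m; rewrite mulr1.
have : m%:R <= h (x m).
  rewrite -tm /h (bigD1_seq m) ?mem_index_iota ?iota_uniq //=.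
  rewrite lerDl sumr_ge0 // => i _; rewrite mulr_ge0 //.
  by have [_ -> _ _] := gP i.
by move/le_trans/(_ (ler_norm _))/le_trans/(_ (hM _)); rewrite leNgt Mm.
Qed.

(** This models the relation that [u] is selected from {u, v}. It need not be transitive. *)
Definition weak_order {X : topologicalType} (R : X -> X -> Prop) :=
  [/\ forall u v, R u v -> exists U V, [/\ open U, open V, U u, V v &
        forall u' v', U u' -> V v' -> R u' v'],
      forall u v, u <> v -> R u v \/ R v u &
      forall u v, R u v -> ~ R v u].

Lemma weak_orderC {X : topologicalType} (R : X -> X -> Prop) :
  weak_order R -> weak_order (fun u v => R v u).
Proof.
move=> [oR tR aR]; split=> [u v /oR[U [V [oU oV Uv Vu UV]]]|u v uv|u v].
- by exists V, U; split=> // u' v' Vu' Uv'; exact: UV.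
- by have [] := tR _ _ uv; [right|left].
- exact: aR.
Qed.

(** Off the diagonal the complement of [R] is the reverse relation, which is open too, so [R] is
    closed there. *)
Lemma weak_order_cvg {X : topologicalType} (R : X -> X -> Prop) (I : Type)
    (F : set_system I) (p q : I -> X) u v :
  ProperFilter F -> weak_order R -> p @ F --> u -> q @ F --> v -> u <> v ->
  (\forall i \near F, R (p i) (q i)) -> R u v.
Proof.
move=> FF [oR tR aR] pu qv uv pq; have [//|/oR] := tR _ _ uv.
move=> [V [U [oV oU Vv Uu VU]]].
have /filter_ex[i [Ui Vi Ri]] :
    \forall i \near F, [/\ U (p i), V (q i) & R (p i) (q i)].
  near=> i; split; near: i => //.
    by apply: pu; exact: open_nbhs_nbhs.
  by apply: qv; exact: open_nbhs_nbhs.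
by have /aR := VU _ _ Vi Ui.
Unshelve. all: by end_near. Qed.

Lemma weak_order_selection {X : topologicalType} (hX : hausdorff_space X)
    (f : hyperspace X -> X) : continuous_selection f ->
  weak_order (fun u v =>
    u <> v /\ f (hyperU (hyper1 hX u) (hyper1 hX v)) = u).
Proof.
move=> [cf sf]; have fE u v : f (hyperU (hyper1 hX u) (hyper1 hX v)) = u \/
    f (hyperU (hyper1 hX u) (hyper1 hX v)) = v.
  by have [] := sf (hyperU (hyper1 hX u) (hyper1 hX v)); [left|right].
split=> [u v [uv fuv]|u v uv|u v [uv fuv] [_]].
(* Once [U] and [V] separate [u] from [v], a point selected from {u', v'} that lies in [U] can only
   be [u']. *)
- have := hX; rewrite open_hausdorff => /(_ u v (introN eqP uv)).
  case=> -[U V] /= [/set_mem Uu /set_mem Vv] [oU oV /eqP UV0].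
  have [A [B [oA oB Au Bv AB]]] : exists A B, [/\ open A, open B, A u, B v &
      forall u' v', A u' -> B v' ->
        U (f (hyperU (hyper1 hX u') (hyper1 hX v')))].
    pose P (w : X * X) := U (f (hyperU (hyper1 hX w.1) (hyper1 hX w.2))).
    have : \forall w \near (u, v), P w.
      have : (fun w : X * X => hyperU (hyper1 hX w.1) (hyper1 hX w.2))
          @ (u, v) --> hyperU (hyper1 hX u) (hyper1 hX v).
        apply: cvg_hyperU; apply: cvg_hyper1; [exact: cvg_fst|exact: cvg_snd].
      move=> /cvg_comp/(_ (cf _)); rewrite fuv => /(_ U); apply.
      by apply: open_nbhs_nbhs.
    move=> [[A B] [/= + +] AB]; rewrite !nbhsE /= => -[A' [oA' A'u] AA'].
    move=> [B' [oB' B'v] BB']; exists A', B'; split=> // u' v' /AA' Au' /BB' Bv'.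
    by apply: (AB (u', v')).
  exists (A `&` U), (B `&` V); split=> //; try exact: openI.
  move=> u' v' [Au' Uu'] [Bv' Vv']; have nUV z : U z -> V z -> False.
    by move=> Uz Vz; have : (U `&` V) z by []; rewrite UV0.
  split=> [u'v'|]; first by apply: (nUV u') => //; rewrite u'v'.
  by have [//|fv] := fE u' v'; have := AB _ _ Au' Bv'; rewrite fv => /nUV /(_ Vv').
- have [fu|fv] := fE u v; [by left|right].
  by split; [move=> vu; apply: uv|rewrite hyperUC].
- by rewrite hyperUC fuv.
Qed.

Lemma regular_open {X : topologicalType} (x : X) (W : set X) :
  @regular_space X -> nbhs x W -> exists U, [/\ open U, U x & closure U `<=` W].
Proof.
move=> rX /rX [V xV VW]; exists V°; split; first exact: open_interior.
- exact: xV.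
- by apply: subset_trans VW; apply: closureS; exact: interior_subset.
Qed.

(** * Countable compactness *)

Lemma open_forall_lt {X : topologicalType} (B : nat -> set X) n :
  (forall i, open (B i)) -> open [set x | forall i, (i < n)%N -> B i x].
Proof.
move=> oB; elim: n => [|n IHn].
  by rewrite [X in open X](_ : _ = setT); [exact: openT|exact/seteqP].
have := openI IHn (oB n); congr open; apply/seteqP; split=> x.
  by move=> [Bx Bn] i; rewrite ltnS leq_eqVlt => /predU1P[->//|]; exact: Bx.
by move=> Bx; split=> [i ilt|]; apply: Bx => //; exact: ltnW.
Qed.

Lemma weak_order_openr {X : topologicalType} (R : X -> X -> Prop) a :
  weak_order R -> open [set r | R a r].
Proof.
move=> [oR _ _]; rewrite openE => r /oR[U [V [oU oV Ua Vr UV]]].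
by apply: (filterS (P := V)) => [s Vs|]; [exact: UV|exact: open_nbhs_nbhs].
Qed.

Definition countably_compact (X : topologicalType) :=
  forall x : nat -> X, cluster (x @ \oo) !=set0.

Section countable_compactness.
Context {X : topologicalType}.
Hypothesis hX : hausdorff_space X.
Hypothesis rX : @regular_space X.
Hypothesis fcX : feebly_compact X.
Hypothesis spmX : selection_pointwise_maximal X.

Lemma countable_base_of_limit (y : X) (C : nat -> set X) :
  (forall n, closed (C n)) -> (forall n, ~ C n y) ->
  closure (\bigcup_n C n) y ->
  exists G : nat -> set X, [/\ forall n, open (G n), forall n, G n y &
    forall W, nbhs y W -> exists n, forall m, (n <= m)%N -> G m `<=` W].
Proof.
move=> cC nC yC; have [f [[cf sf] fmax]] := spmX y.
(* [c] makes every [E k] nonempty, including [E 0]. *)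
have [c [[n0 _ Cc] _]] := yC setT filterT.
have cE k : closed (c |` \bigcup_(i in `I_k) C i).
  apply: closedU; first exact: closed_point.
  by apply: closed_bigcup => //; exact: finite_II.
have E0 k : (c |` \bigcup_(i in `I_k) C i) !=set0 by exists c; left.
pose E k := Hyperspace (cE k) (E0 k).
have Ey k : ~ hset (E k) y.
  by move=> [yc|[i _ /nC//]]; apply: (nC n0); rewrite yc.
have [B BP] : exists B : nat -> set X, forall k, [/\ open (B k), B k y &
    forall z, closure (B k) z -> f (hyperU (E k) (hyper1 hX z)) = z].
  suff /choice[B BP] : forall k : nat, exists Bk : set X,
    [/\ open Bk, Bk y & forall z, closure Bk z ->
      f (hyperU (E k) (hyper1 hX z)) = z] by exists B.
  move=> k.
  have fy : f (hyperU (E k) (hyper1 hX y)) = y by apply: fmax; right.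
  (* The closed set [E k] misses y = f(E_k u {y}), so for [z] near [y] the value f(E_k u {z}) avoids
     [E k] and must be [z]. *)
  have : \forall z \near y, ~ hset (E k) (f (hyperU (E k) (hyper1 hX z))).
    have : (fun z => hyperU (E k) (hyper1 hX z)) @ y
        --> hyperU (E k) (hyper1 hX y).
      by apply: cvg_hyperU; [exact: cvg_cst|exact: cvg_hyper1].
    move=> /cvg_comp/(_ (cf _)); rewrite fy => /(_ (~` hset (E k))); apply.
    apply: open_nbhs_nbhs; split; last exact: Ey.
    exact/closed_openC/cE.
  move=> /(regular_open rX)[U [oU Uy UE]]; exists U; split=> // z /UE.
  by have [|] := sf (hyperU (E k) (hyper1 hX z)).
have By z : (forall k, closure (B k) z) -> z = y.
  (* The sets E_k u {z} increase to a set containing [y], where [f] is [y], although [f] equals [z]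
     on each of them. *)
  move=> Bz; pose E' k := hyperU (E k) (hyper1 hX z).
  have S0 : closure (\bigcup_k hset (E' k)) !=set0.
    by exists z; apply: subset_closure; exists 0%N => //; right.
  pose S := Hyperspace (@closed_closure _ _) S0.
  have E'S : E' @ \oo --> S.
    apply: cvg_hyper_increasing => // m n mn x [[Ex|[i im Cx]]|Ex].
    - by left; left.
    - by left; right; exists i => //; exact: leq_trans mn.
    - by right.
  have fS : f S = y.
    apply: fmax; apply: closureS yC => x [n _ Cx].
    by exists n.+1 => //; left; right; exists n => /=.
  have : f \o E' @ \oo --> y by rewrite -fS; exact: cvg_comp E'S (cf _).
  have -> : f \o E' = fun=> z.
    by apply/funext => k /=; have [_ _] := BP k; apply.
  by move=> zy; apply: (cvg_unique hX (cvg_cst z : (fun _ : nat => z) @ \oo --> z)).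
pose G n := [set x | forall i, (i < n.+1)%N -> B i x].
have oG n : open (G n) by apply: open_forall_lt => i; have [] := BP i.
have dG m n : (m <= n)%N -> G n `<=` G m.
  by move=> mn x Gx i im; apply: Gx; exact: leq_trans im _.
exists G; split=> // [n i _|W yW]; first by have [] := BP i.
have [W' [oW' W'y W'W]] := regular_open rX yW.
(* Otherwise the open sets [G n] minus [closure W'] accumulate at a point of every [closure (B k)],
   that is at [y], which [W'] rules out. *)
apply: contrapT => nG.
have nGW n : (G n `\` closure W') !=set0.
  apply: contrapT => GW; apply: nG; exists n => m nm x /(dG _ _ nm) Gx.
  by apply: W'W; apply: contrapT => nWx; apply: GW; exists x.
have [|z zP] := fcX (U := fun n => G n `\` closure W') _ nGW.
  by move=> n; apply: openI => //; exact/closed_openC/closed_closure.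
have zy : z = y.
  apply: By => k A zA; have [m km [x [[Gx _] Ax]]] := zP A zA k.
  by exists x; split=> //; exact: Gx.
have zW' : nbhs z W' by apply: open_nbhs_nbhs; rewrite zy.
by have [m _ [x [[_ nx] /subset_closure]]] := zP W' zW' 0%N.
Qed.

(** If a point lies in infinitely many [U n], a constant sequence works. Otherwise shrink to [V n]
    and take a cluster point [y]: the closures of the late [V n] miss [y] and accumulate at it, so
    [y] has a countable base. *)
Lemma open_sequence_cvg (U : nat -> set X) :
  (forall n, open (U n)) -> (forall n, U n !=set0) ->
  exists (y : X) (n : nat -> nat) (u : nat -> X),
    [/\ forall k, (k <= n k)%N, forall k, U (n k) (u k) & u @ \oo --> y].
Proof.
move=> oU U0.
have [[x Ux]|nx] := pselect (exists x, forall k, exists2 n, (k <= n)%N & U n x).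
  have pick k : exists n, (k <= n)%N /\ U n x.
    by have [n kn Un] := Ux k; exists n.
  have [n nP] := choice pick.
  exists x, n, (fun=> x); split=> [k|k|]; last exact: cvg_cst.
  - by have [] := nP k.
  - by have [] := nP k.
have [V VP] : exists V : nat -> set X, forall n, [/\ open (V n), V n !=set0 &
    closure (V n) `<=` U n].
  suff /choice[V VP] : forall n : nat, exists Vn : set X,
    [/\ open Vn, Vn !=set0 & closure Vn `<=` U n] by exists V.
  move=> n; have [x Ux] := U0 n.
  have [|V [oV Vx VU]] := @regular_open _ x (U n) rX; first exact: open_nbhs_nbhs.
  by exists V; split=> //; exists x.
have [y yV] : exists y, frequently_meets V y.
  by apply: fcX => n; have [] := VP n.
have [k yk] : exists k, forall n, (k <= n)%N -> ~ U n y.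
  apply: contrapT => nk; apply: nx; exists y => k; apply: contrapT => kU.
  by apply: nk; exists k => n kn Uy; apply: kU; exists n.
have [G [oG Gy yG]] : exists G : nat -> set X, [/\ forall n, open (G n),
    forall n, G n y &
    forall W, nbhs y W -> exists n, forall m, (n <= m)%N -> G m `<=` W].
  apply: (@countable_base_of_limit y (fun n => closure (V (k + n)%N))).
  - by move=> n; exact: closed_closure.
  - move=> n; have [_ _ VU] := VP (k + n)%N => /VU.
    by apply: yk; exact: leq_addr.
  - move=> W /yV /(_ k)[m km [x [Vx Wx]]]; exists x; split=> //.
    by exists (m - k)%N => //; apply: subset_closure; rewrite subnKC.
have pick i : exists nu : nat * X, [/\ (i <= nu.1)%N, V nu.1 nu.2 & G i nu.2].
  have [m im [x [Vx Gx]]] := yV (G i) (open_nbhs_nbhs (conj (oG i) (Gy i))) i.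
  by exists (m, x).
have [nu nuP] := choice pick.
exists y, (fun i => (nu i).1), (fun i => (nu i).2); split=> [i|i|W].
- by have [] := nuP i.
- have [_ Vi _] := nuP i; have [_ _ VU] := VP (nu i).1.
  exact/VU/subset_closure.
- move=> /yG[n nW]; exists n => // m /nW; apply.
  by have [] := nuP m.
Qed.

Lemma cvg_subsequence (u : nat -> X) (n : nat -> nat) (y : X) :
  (forall k, (k <= n k)%N) -> u @ \oo --> y -> (u \o n) @ \oo --> y.
Proof.
move=> kn uy W /uy[m _ mW]; exists m => // k mk; apply: mW => /=.
exact: leq_trans mk _.
Qed.

Lemma open_sequence_cvg2 (U V : nat -> set X) :
  (forall n, open (U n)) -> (forall n, U n !=set0) ->
  (forall n, open (V n)) -> (forall n, V n !=set0) ->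
  exists (p q : X) (n : nat -> nat) (u v : nat -> X),
    [/\ forall k, (k <= n k)%N, forall k, U (n k) (u k),
        forall k, V (n k) (v k), u @ \oo --> p & v @ \oo --> q].
Proof.
move=> oU U0 oV V0; have [p [m [u [km Uu up]]]] := open_sequence_cvg oU U0.
have [q [n [v [kn Vv vq]]]] :=
  @open_sequence_cvg (V \o m) (fun k => oV (m k)) (fun k => V0 (m k)).
exists p, q, (m \o n), (u \o n), v; split=> // [k|k|].
- by apply: leq_trans (kn k) _; exact: km.
- exact: Uu.
- exact: cvg_subsequence.
Qed.

Section ultrafilter.
Context (x : nat -> X) (Z : set_system nat) {UZ : UltraFilter Z}.
Hypothesis Zoo : forall n, Z [set m | (n <= m)%N].
Hypothesis xdiscrete : forall y : X,
  exists2 W, nbhs y W & exists n, forall m, (n <= m)%N -> ~ W (x m).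

(** For a weak order, this set and the one of the reverse relation partition the space; once both
    are open they are clopen. *)
Let below (R : X -> X -> Prop) := [set u | Z [set j | R u (x j)]].

(* Near a bad point [u] of [below R] one finds open sets [P k] and [Q k] such that
   [R q p] holds on [P k `*` Q k] but [R p q] holds on [P k `*` Q j] for j < k.
   Limits [p] and [q] of points of a common subsequence then satisfy both [R q p]
   (diagonal limit) and [R p q] (iterated limit). *)
Lemma open_below R : weak_order R -> open (below R).
Proof.
move=> wR; have [oR tR aR] := wR; rewrite openE => u Pu; apply: contrapT => nP.
(* The sets P k will lie in [O2], the sets Q k outside [closure O1], and late terms of [x] lie
   outside [W0]. This keeps the limits [p] and [q] distinct. *)
have [W0 /(regular_open rX)[O0 [oO0 O0u O0W]] [n0 xW0]] := xdiscrete u.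
have [O1 [oO1 O1u O10]] := regular_open rX (open_nbhs_nbhs (conj oO0 O0u)).
have [O2 [oO2 O2u O21]] := regular_open rX (open_nbhs_nbhs (conj oO1 O1u)).
pose good O := [/\ open O, O u & O `<=` O2].
(* [t] is the triple (P k, Q k, O k.+1). Later P j lie in O k.+1, so the clause on [t.2] covers
   every j > k. *)
pose next (O : set X) (t : set X * set X * set X) :=
  [/\ [/\ open t.1.1, t.1.1 !=set0, open t.1.2 & t.1.2 !=set0],
      [/\ good t.2, t.2 `<=` O & t.1.1 `<=` O],
      forall p q, t.1.1 p -> t.1.2 q -> R q p,
      forall o q, t.2 o -> t.1.2 q -> R o q &
      t.1.2 `<=` ~` closure O1].
have step O : exists t, good O -> next O t.
  have [[oO Ou OO2]|nO] := pselect (good O); last by exists (O, O, O).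
  (* As [u] is in [below R] and [u'] is not, some late [x j] satisfies [R u (x j)] but not
     [R u' (x j)]; the set Q k is a neighbourhood of it. *)
  have [u' Ou' nPu'] : exists2 u', O u' & ~ below R u'.
    apply: contrapT => h; apply: nP; apply: (filterS (P := O)) => [z Oz|].
      by apply: contrapT => nz; apply: h; exists z.
    exact: open_nbhs_nbhs.
  have [/nPu'//|Zu'] := in_ultra_setVsetC [set j | R u' (x j)] UZ.
  have [j [[/= nRj Rj] n0j]] := filter_ex (filterI (filterI Zu' Pu) (Zoo n0)).
  have nO1 : ~ closure O1 (x j).
    by move=> /O10/subset_closure/O0W; exact: xW0.
  have ju' : x j <> u'.
    move=> ju'; apply: nO1.
    by apply/subset_closure/O21/subset_closure/OO2; rewrite ju'.
  have [Rju'|//] := tR _ _ ju'.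
  have [Q1 [P1 [oQ1 oP1 Q1j P1u' QP]]] := oR _ _ Rju'.
  have [O' [Q2 [oO' oQ2 O'u Q2j OQ]]] := oR _ _ Rj.
  exists (P1 `&` O, Q1 `&` Q2 `&` ~` closure O1, O' `&` O) => _; split=> /=.
  - split; [exact: openI|by exists u'| |by exists (x j)].
    by apply: openI; [exact: openI|exact/closed_openC/closed_closure].
  - split; [split; [exact: openI| |]| |]; try by move=> z [].
      by [].
    by move=> z [_ /OO2].
  - by move=> p q [P1p _] [[Q1q _] _]; exact: QP.
  - by move=> o q [O'o _] [[_ Q2q] _]; exact: OQ.
  - by move=> z [].
have [F FP] := choice step.
pose O k := iter k (fun O => (F O).2) O2.
have gO k : good (O k).
  elim: k => [|k gk]; first by split.
  by have [_ []] := FP _ gk.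
have dO m n : (m <= n)%N -> O n `<=` O m.
  elim: n => [|n IHn]; first by rewrite leqn0 => /eqP ->.
  rewrite leq_eqVlt => /predU1P[->//|/IHn]; apply: subset_trans.
  by have [_ []] := FP _ (gO n).
have [||||p [q [n [a [b [kn Ua Vb ap bq]]]]]] :=
    @open_sequence_cvg2 (fun k => (F (O k)).1.1) (fun k => (F (O k)).1.2);
  try by move=> k; have [[]] := FP _ (gO k).
have aO k : O (n k) (a k).
  by have [_ [_ _ PO] _ _ _] := FP _ (gO (n k)); exact/PO/Ua.
have O1p : O1 p.
  apply: O21; have := @closed_cvg _ _ \oo _ a (closure O2) (@closed_closure _ _).
  apply=> //; apply: filterE => k; apply: subset_closure.
  by have [_ _] := gO (n k); apply.
have nO1b k : ~ O1 (b k).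
  have [_ _ _ _ QO] := FP _ (gO (n k)) => /subset_closure.
  by apply: QO; exact: Vb.
have nO1q : ~ O1 q.
  move=> O1q; have [|k _ kO] := bq O1; first exact: open_nbhs_nbhs.
  by apply: (nO1b k); apply: kO => /=.
have pq : p <> q by move=> pq; apply: nO1q; rewrite -pq.
have Rqp : R q p.
  apply: weak_order_cvg wR bq ap _ _; first exact: nesym.
  apply: filterE => k; have [_ _ QP _ _] := FP _ (gO (n k)).
  by apply: QP; [exact: Ua|exact: Vb].
(* The inner limit: for fixed [k] and i > n k, the point [a i] lies in [O (n k).+1] because i <= n
   i. *)
have Rpb k : R p (b k).
  apply: weak_order_cvg wR ap (cvg_cst _) _ _.
    by move=> pb; apply: (nO1b k); rewrite -pb.
  exists (n k).+1 => // i /= ki; have [_ _ _ OQ _] := FP _ (gO (n k)).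
  apply: OQ (Vb k); apply: (dO (n k).+1 (n i)) (aO i).
  exact: leq_trans (kn i).
apply: (aR _ _ Rqp); apply: weak_order_cvg wR (cvg_cst p) bq pq _.
exact: filterE.
Qed.

(** By [xdiscrete], late terms differ from [u], so totality of [R] applies to them. *)
Lemma below_total R u : weak_order R ->
  below R u \/ below (fun a b => R b a) u.
Proof.
move=> [_ tR _]; have [|Zu] := in_ultra_setVsetC [set j | R u (x j)] UZ.
  by left.
right; have [W uW [n xW]] := xdiscrete u.
apply: filterS (filterI Zu (Zoo n)) => j [/= nR nj].
have [|//|//] := tR u (x j) => uj.
by apply: (xW _ nj); rewrite -uj; exact: nbhs_singleton.
Qed.

(* Points of [V n] are in [below R] and [R]-above the first [n] terms [x i] lying
   in [below R]. Since [below R] is clopen, a cluster point [y] of the [V n] lies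
   in it, although [R y (x i)] fails for all these [i]. *)
Lemma below_not_large R : weak_order R -> ~ Z [set i | below R (x i)].
Proof.
move=> wR ZP; have oP := open_below wR; have oP' := open_below (weak_orderC wR).
have [oR _ aR] := wR.
pose V n := below R `&`
  [set r | forall i, (i < n)%N -> [set r | below R (x i) -> R (x i) r] r].
have [| |y yV] := fcX (U := V).
- move=> n; apply: openI => //.
  apply: (open_forall_lt (B := fun i => [set r | below R (x i) -> R (x i) r])) => i.
  have [Pi|nPi] := pselect (below R (x i)).
    have := @weak_order_openr _ R (x i) wR; congr open.
    by apply/seteqP; split=> r //=; apply.
  rewrite [X in open X](_ : _ = setT); first exact: openT.
  by apply/seteqP; split=> r //= _ /nPi.
- move=> n.
  (* Finitely many [Z]-large conditions hold at a common [j], and [x j] is then a point of [V n]. *)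
  have : Z [set j | forall i, (i < n)%N -> below R (x i) -> R (x i) (x j)].
    elim: n => [|n IHn]; first exact: filterE.
    have [Pn|nPn] := pselect (below R (x n)); last first.
      apply: filterS IHn => j IH i.
      by rewrite ltnS leq_eqVlt => /predU1P[->//|]; exact: IH.
    apply: filterS (filterI IHn Pn) => j [IH Rn] i.
    by rewrite ltnS leq_eqVlt => /predU1P[->//|]; exact: IH.
  by move=> ZR; have [j [Pj Rj]] := filter_ex (filterI ZP ZR); exists (x j).
have Py : below R y.
  have [//|P'y] := @below_total R y wR.
  have [|m _ [z [[Pz _] P'z]]] := yV (below (fun a b => R b a)) _ 0%N.
    exact: open_nbhs_nbhs.
  by have [j [/= /aR]] := filter_ex (filterI Pz P'z).
have [i [/= /oR[U [W [oU oW Uy Wi UW]]] Pi]] := filter_ex (filterI Py ZP).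
have [|m im [z [[_ Vz] Uz]]] := yV U _ i.+1; first exact: open_nbhs_nbhs.
by apply: (aR _ _ (UW _ _ Uz Wi)); exact: Vz.
Qed.

End ultrafilter.

(** Without a cluster point, every [x i] is in [below] of the selection relation or of its reverse,
    so one of the two alternatives holds for [Z]-most [i]; [below_not_large] forbids both. *)
Lemma selection_pointwise_maximal_countably_compact : countably_compact X.
Proof.
move=> x; apply: contrapT => nx.
have xd (y : X) : exists2 W, nbhs y W & exists n, forall m, (n <= m)%N -> ~ W (x m).
  apply: contrapT => h; apply: nx; exists y => A B [n _ nA] yB.
  apply: contrapT => AB; apply: h; exists B => //; exists n => m nm Bm.
  by apply: AB; exists (x m); split=> //; exact: nA.
have [Z [UZ ooZ]] := @ultraFilterLemma _ \oo _.
have Zoo n : Z [set m | (n <= m)%N] by apply: ooZ; exists n.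
have [f [csf _]] := spmX (x 0%N).
have wR := weak_order_selection hX csf; set R := (fun u v => _) in wR.
have [|Zc] := in_ultra_setVsetC [set i | Z [set j | R (x i) (x j)]] UZ.
  exact: below_not_large.
apply: (below_not_large Zoo xd (weak_orderC wR)).
by apply: filterS Zc => i; have [] := below_total Zoo xd (x i) wR.
Qed.

End countable_compactness.

(** * Convergence along ultrafilters *)

Definition omega_bounded (X : topologicalType) :=
  forall M : set X, countable M -> compact (closure M).

Lemma countably_compact_bigcap {X : topologicalType} (Q : nat -> set X) :
  countably_compact X -> (forall n, closed (Q n)) -> (forall n, Q n !=set0) ->
  (forall m n, (m <= n)%N -> Q n `<=` Q m) -> exists y, forall n, Q n y.
Proof.
move=> cX cQ Q0 dQ; have [x Qx] := choice Q0; have [y yx] := cX x.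
exists y => n; apply: cQ => W /(yx [set x m | m in [set m | (n <= m)%N]]) [].
  by exists n => // m /= nm; exists m.
by move=> _ [[m /= nm <-] Wx]; exists (x m); split=> //; exact: dQ (Qx m).
Qed.

Section omega_boundedness.
Context {X : topologicalType} (R : X -> X -> Prop).
Hypothesis cX : countably_compact X.
Hypothesis wR : weak_order R.

(** At most one point of the closure is below no [m i] with [i] in [I]: if [R a b] for two such
    points, the open set of [r] with [R a r] contains [b], hence some [m i]. Countable compactness
    yields such a point, and again, with the complement of a neighbourhood added, convergence of [Z]
    to it. *)
Lemma ultra_cvg_below (Z : set_system X) (m : nat -> X) (I : set nat) :
  UltraFilter Z -> Z (closure (m @` I)) ->
  (forall i, I i -> Z [set y | ~ R y (m i)]) ->
  exists2 y, closure (m @` I) y & Z --> y.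
Proof.
move=> UZ ZI ZR; have [oR tR aR] := wR.
pose B i := [set y | I i -> ~ R y (m i)].
have cB i : closed (B i).
  have [Ii|nIi] := pselect (I i); last first.
    rewrite [X in closed X](_ : _ = setT); first exact: closedT.
    by apply/seteqP; split=> y //= _ /nIi.
  rewrite [X in closed X](_ : _ = ~` [set y | R y (m i)]).
    by apply: open_closedC; exact: (weak_order_openr (m i) (weak_orderC wR)).
  by apply/seteqP; split=> y; [move=> /(_ Ii)|move=> nR _].
pose Q n := closure (m @` I) `&` [set y | forall i, (i < n)%N -> B i y].
have cQ n : closed (Q n).
  apply: closedI; first exact: closed_closure.
  rewrite [X in closed X](_ : _ = \bigcap_(i in `I_n) B i).
    by apply: closed_bigI.
  by apply/seteqP; split=> y /= By i => [/=|]; exact: By.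
have dQ a b : (a <= b)%N -> Q b `<=` Q a.
  by move=> ab y [Iy Qy]; split=> // i ia; apply: Qy; exact: leq_trans ab.
have ZB n : Z [set y | forall i, (i < n)%N -> B i y].
  elim: n => [|n IHn]; first exact: filterE.
  have ZBn : Z (B n).
    have [In|nIn] := pselect (I n).
      by apply: filterS (ZR n In) => y nR _.
    by apply: filterE => y /nIn.
  apply: filterS (filterI IHn ZBn) => y [IH Bn] i.
  by rewrite ltnS leq_eqVlt => /predU1P[->//|]; exact: IH.
have ZQ n : Z (Q n) by exact: filterI.
have uniq y z : (forall n, Q n y) -> (forall n, Q n z) -> y = z.
  have half a b : (forall n, Q n a) -> (forall n, Q n b) -> ~ R a b.
    move=> Qa Qb Rab; have [Ib _] := Qb 0%N.
    have [_ [[i Ii <-] /= Ri]] := Ib [set r | R a r]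
      (open_nbhs_nbhs (conj (weak_order_openr a wR) Rab)).
    by have [_ /(_ i (ltnSn i) Ii)] := Qa i.+1.
  move=> Qy Qz; apply: contrapT => /tR[]; exact: half.
have [y Qy] := countably_compact_bigcap cX cQ (fun n => filter_ex (ZQ n)) dQ.
exists y; first by have [] := Qy 0%N.
move=> W; rewrite nbhsE => -[V [oV Vy] VW]; apply: filterS VW _.
have [//|ZV] := in_ultra_setVsetC V UZ.
have [|z QVz] := countably_compact_bigcap cX
    (fun n => closedI (cQ n) (open_closedC oV))
    (fun n => filter_ex (filterI (ZQ n) ZV)).
  by move=> a b ab x [Qx Vx]; split=> //; exact: dQ Qx.
have zy : z = y by apply: uniq => // n; have [] := QVz n.
by have [_] := QVz 0%N; rewrite zy.
Qed.

End omega_boundedness.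

(** Indices are sorted by the side of [m i] on which [Z] lives. The closure of [M] is the union of
    the closures of the two parts; [Z] contains one of them, and [ultra_cvg_below] applies to [R] or
    to its reverse. *)
Lemma weak_order_omega_bounded {X : topologicalType} (R : X -> X -> Prop) :
  countably_compact X -> weak_order R -> omega_bounded X.
Proof.
move=> cX wR M cM; have [->|/set0P M0] := eqVneq M set0.
  by rewrite closure0; exact: compact0.
have [m mM] : exists m : nat -> X, range m = M.
  have /countable_injP[g gI] := cM; have [x0 Mx0] := M0.
  pose m n := xget x0 [set x | M x /\ g x = n].
  exists m; apply/seteqP; split=> [_ [n _ <-]|x Mx].
    by rewrite /m; case: xgetP => // y _ [].
  exists (g x) => //; have [My gy] : M (m (g x)) /\ g (m (g x)) = g x.
    by rewrite /m; case: xgetP => [y _ []//|/(_ x)[]].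
  by apply: gI => //; exact/mem_set.
rewrite compact_ultra => Z UZ; rewrite -mM => ZM.
pose I := [set i | Z [set y | ~ R y (m i)]].
have rm : range m = m @` I `|` m @` (~` I) by rewrite -image_setU setUv.
have [ZI|ZnI] := in_ultra_setVsetC (closure (m @` I)) UZ.
  have [//|y Iy Zy] := ultra_cvg_below cX wR UZ ZI.
  by exists y; split=> //; rewrite rm closureU; left.
have ZnI' : Z (closure (m @` (~` I))).
  apply: filterS (filterI ZM ZnI) => y [].
  by rewrite rm closureU => -[].
have [i nIi|y Iy Zy] := ultra_cvg_below cX (weak_orderC wR) UZ ZnI'.
  have [//|] := in_ultra_setVsetC [set y | ~ R y (m i)] UZ.
  apply: filterS => y /contrapT; have [_ _ aR] := wR; exact: aR.
by exists y; split=> //; rewrite rm closureU; right.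
Qed.

Section ultralimits.
Context {X : topologicalType} (D : set_system nat) {UD : UltraFilter D}.
Hypothesis bX : omega_bounded X.

Lemma ultra_cvg (x : nat -> X) : exists2 y : X, cluster (x @ D) y & x @ D --> y.
Proof.
have cx : countable (range x) by apply: sub_countable (card_image_le _ _) _.
have [|y [_ xy]] := bX cx (F := x @ D).
  by apply: (@filterE _ D) => n; apply: subset_closure; exists n.
exists y => // W yW; have [//|DW] := in_ultra_setVsetC [set n | W (x n)] UD.
by have [z [nWz Wz]] := xy (~` W) W DW yW.
Qed.

(** The limit is the upper limit of the [T k] along [D]. If [D]-most [T k] left an open [V]
    containing it, points of [T k] outside [V] would have a limit in [S] outside [V]. *)
Lemma ultra_hyper_cvg (T : nat -> hyperspace X) :
  exists S : hyperspace X, T @ D --> S.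
Proof.
pose S := \bigcap_(A in D) closure (\bigcup_(k in A) hset (T k)).
have limS x : (forall k, hset (T k) (x k)) -> cluster (x @ D) `<=` S.
  move=> Tx y xy A DA W yW.
  have DxA : D (x @^-1` (x @` A)) by apply: filterS DA => k Ak; exists k.
  have [_ [[k Ak <-] Wx]] := xy (x @` A) W DxA yW.
  by exists (x k); split=> //; exists k.
have cS : closed S by apply: closed_bigI => A _; exact: closed_closure.
have S0 : S !=set0.
  have [x Tx] := choice (fun k => hset_neq0 (T k)).
  by have [y xy _] := ultra_cvg x; exists y; exact: limS xy.
exists (Hyperspace cS S0); apply: hyper_cvg => V oV /=.
  move=> SV; have [//|DV] := in_ultra_setVsetC [set k | hset (T k) `<=` V] UD.
  have pick k : exists y, hset (T k) y /\ (~ hset (T k) `<=` V -> ~ V y).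
    have [TV|/existsNP[y /not_implyP[Ty nVy]]] := pselect (hset (T k) `<=` V).
      by have [y Ty] := hset_neq0 (T k); exists y.
    by exists y.
  have [x xP] := choice pick; have [y xy _] := ultra_cvg x.
  have Vy : V y by apply: SV; apply: limS xy => k; have [] := xP k.
  have [z [nVz Vz]] := xy (~` V) V
    (filterS (fun k => (xP k).2) DV) (open_nbhs_nbhs (conj oV Vy)).
  by have := nVz Vz.
move=> [t [St Vt]].
have [//|DV] := in_ultra_setVsetC [set k | hset (T k) `&` V !=set0] UD.
have [z [[k nk Tz] Vz]] := St _ DV V (open_nbhs_nbhs (conj oV Vt)).
by exfalso; apply: nk; exists z.
Qed.

End ultralimits.

Lemma eventually_ultrafilter : exists D : set_system nat,
  UltraFilter D /\ forall n, D [set m | (n <= m)%N].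
Proof.
have [D [UD ooD]] := @ultraFilterLemma _ \oo _.
by exists D; split=> // n; apply: ooD; exists n.
Qed.

(** * Uniform continuity for a pseudometric *)

Lemma natSinv_lt (R : realType) (e : R) : 0 < e ->
  exists N, forall n, (N <= n)%N -> n.+1%:R^-1 < e.
Proof.
move=> e0; exists (Num.bound e^-1) => n Nn.
have e1 : 0 < e^-1 by rewrite invr_gt0.
rewrite invf_plt ?posrE //; apply: lt_le_trans (archi_boundP (ltW e1)) _.
by rewrite ler_nat; exact: leqW.
Qed.

Section translation_pseudometric.
Context {R : realType} {X : topologicalType}.
Hypothesis hX : hausdorff_space X.
Hypothesis cX : countably_compact X.
Hypothesis bX : omega_bounded X.
Variable phi : hyperspace X -> R.
Hypothesis cphi : continuous phi.
Hypothesis phi01 : forall S, 0 <= phi S <= 1.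

Let cvg_phi (I : Type) (F : set_system I) (T : I -> hyperspace X)
    (S : hyperspace X) :
  T @ F --> S -> (fun i => phi (T i)) @ F --> phi S.
Proof. by move=> TS; exact: cvg_comp TS (@cphi S). Qed.

Let gap (x y : X) (K : hyperspace X) : R :=
  `|phi (hyperU (hyper1 hX x) K) - phi (hyperU (hyper1 hX y) K)|.

Definition translation_dist (x y : X) : R := sup (range (gap x y)).

Local Notation rho := translation_dist.

Let gap_le1 x y K : gap x y K <= 1.
Proof.
have /andP[a0 a1] := phi01 (hyperU (hyper1 hX x) K).
have /andP[b0 b1] := phi01 (hyperU (hyper1 hX y) K).
by rewrite /gap ler_norml; apply/andP; split; lra.
Qed.

Lemma gap_le_translation_dist x y K : gap x y K <= rho x y.
Proof.
apply: ub_le_sup; last by exists K.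
by exists 1 => _ [L _ <-]; exact: gap_le1.
Qed.

Lemma translation_dist_le x y e : (forall K, gap x y K <= e) -> rho x y <= e.
Proof.
move=> ge; apply: ge_sup => [|_ [K _ <-]]; last exact: ge.
by exists (gap x y (hyper1 hX x)), (hyper1 hX x).
Qed.

Lemma translation_dist_norm_le1 x y : `|rho x y| <= 1.
Proof.
rewrite ger0_norm; first by apply: translation_dist_le => K; exact: gap_le1.
exact: le_trans (normr_ge0 _) (gap_le_translation_dist x y (hyper1 hX x)).
Qed.

Lemma translation_distC x y : rho x y = rho y x.
Proof.
by congr sup; apply/seteqP; split=> _ [K _ <-]; exists K => //; rewrite /gap distrC.
Qed.

Lemma translation_distxx x : rho x x <= 0.
Proof. by apply: translation_dist_le => K; rewrite /gap subrr normr0. Qed.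

Lemma translation_dist_triangle y x z : rho x z <= rho x y + rho y z.
Proof.
apply: translation_dist_le => K.
apply: le_trans (lerD (gap_le_translation_dist x y K)
                      (gap_le_translation_dist y z K)).
exact: ler_distD.
Qed.

Lemma cvg_gap (F : set_system nat) (x y : nat -> X) (K : nat -> hyperspace X)
    (a b : X) (L : hyperspace X) :
  Filter F -> x @ F --> a -> y @ F --> b -> K @ F --> L ->
  (fun n => gap (x n) (y n) (K n)) @ F --> gap a b L.
Proof.
move=> FF xa yb KL; apply: cvg_norm; apply: cvgB.
  exact: cvg_phi (cvg_hyperU FF (cvg_hyper1 FF xa) KL).
exact: cvg_phi (cvg_hyperU FF (cvg_hyper1 FF yb) KL).
Qed.

(* Otherwise one builds [y k] and [K k] with [e < gap x (y k) (K k)], and with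
   [gap x (y k) (K j) <= e / 2] for j < k; their limits [b] and [L] along an
   ultrafilter would satisfy both [e <= gap x b L] and [gap x b L <= e / 2]. *)
Lemma translation_dist_near x (e : R) : 0 < e -> \forall y \near x, rho x y <= e.
Proof.
move=> e0; apply: contrapT => nx.
pose good (O : set X) := open O /\ O x.
(* [t] is the triple (y k, K k, O k.+1). *)
pose next O (t : X * hyperspace X * set X) := [/\ O t.1.1,
  e < gap x t.1.1 t.1.2, good t.2, t.2 `<=` O &
  forall z, t.2 z -> gap x z t.1.2 <= e / 2].
have step O : exists t, good O -> next O t.
  have [[oO Ox]|nO] := pselect (good O); last by exists (x, hyper1 hX x, O).
  have [y [K [Oy eK]]] : exists y K, O y /\ e < gap x y K.
    apply: contrapT => h; apply: nx; apply: (filterS (P := O)).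
      move=> y Oy; apply: translation_dist_le => K; rewrite leNgt; apply/negP => eK.
      by apply: h; exists y, K.
    exact: open_nbhs_nbhs.
  have : \forall z \near x, gap x z K < e / 2.
    have : gap x z K @[z --> x] --> gap x x K.
      apply: cvg_norm; apply: cvgB; first exact: cvg_cst.
      apply: cvg_phi; apply: cvg_hyperU; last exact: cvg_cst.
      by apply: cvg_hyper1; exact: cvg_id.
    rewrite [gap x x K]/gap subrr normr0 => /(_ [set r | r < e / 2]); apply.
    by apply: open_nbhs_nbhs; split; [exact: open_lt|rewrite /= divr_gt0].
  rewrite /prop_near1 nbhsE => -[U [oU Ux] Ue].
  exists (y, K, U `&` O) => _; split=> //=.
  - by split=> //; exact: openI.
  - by move=> z [/Ue/ltW].
have [F FP] := choice step.
pose O k := iter k (fun O => (F O).2) setT.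
have gO k : good (O k).
  elim: k => [|k gk]; first by split=> //; exact: openT.
  by have [_ _ []] := FP _ gk.
have dO m n : (m <= n)%N -> O n `<=` O m.
  elim: n => [|n IHn]; first by rewrite leqn0 => /eqP ->.
  rewrite leq_eqVlt => /predU1P[->//|/IHn]; apply: subset_trans.
  by have [_ _ _ +] := FP _ (gO n).
have [D [UD Doo]] := eventually_ultrafilter.
pose y k := (F (O k)).1.1; pose K k := (F (O k)).1.2.
have [b _ yb] := ultra_cvg bX y.
have [L KL] := ultra_hyper_cvg bX K.
have gbK j : gap x b (K j) <= e / 2.
  apply: (ler_cvg_to (cvg_gap _ (cvg_cst x) yb (cvg_cst (K j))) (cvg_cst _)).
  apply: filterS (Doo j.+1) => k /= jk.
  have [_ _ _ _] := FP _ (gO j); apply; apply: (dO j.+1 k jk).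
  by have [] := FP _ (gO k).
have gbL : gap x b L <= e / 2.
  apply: (ler_cvg_to (cvg_gap _ (cvg_cst x) (cvg_cst b) KL) (cvg_cst _)).
  exact: filterE.
have : e <= gap x b L.
  apply: (ler_cvg_to (cvg_cst _) (cvg_gap _ (cvg_cst x) yb KL)).
  by apply: filterE => k; have [_ /ltW] := FP _ (gO k).
by lra.
Qed.

Lemma translation_dist_continuous a : continuous (rho a).
Proof.
move=> x; apply/cvgrPdist_le => e e0.
apply: filterS (translation_dist_near x e0) => y xy.
have := translation_dist_triangle x a y.
have := translation_dist_triangle y a x.
by rewrite (translation_distC y x) ler_norml => h1 h2; apply/andP; split; lra.
Qed.

(** Points of [B] can be added to [A] one at a time, since exchanging [a] for [b] at distance zero
    preserves phi({a} u K). Finite subsets approximating [B] do the rest. *)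
Lemma absorb_translation_dist0 (A B : hyperspace X) :
  (forall b, hset B b -> exists2 a, hset A a & rho a b <= 0) ->
  phi (hyperU A B) = phi A.
Proof.
move=> AB; have fin (s : seq X) : {in s, forall b, hset B b} ->
    exists K, [/\ hset K = hset A `|` [set` s] & phi K = phi A].
  elim: s => [|b s IHs] sB.
    by exists A; split=> //; rewrite set_nil setU0.
  have [|K [KA phiK]] := IHs; first by move=> c cs; apply: sB; rewrite inE cs orbT.
  have [a Aa ab] := AB b (sB b (mem_head _ _)).
  exists (hyperU (hyper1 hX b) K); split=> /=.
    rewrite KA; apply/seteqP; split=> z /=; rewrite inE.
      by move=> [->|[Az|zs]]; [right; rewrite eqxx|left|right; rewrite zs orbT].
    by move=> [Az|/predU1P[->|zs]]; [right; left|left|right; right].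
  have := le_trans (gap_le_translation_dist a b K) ab.
  rewrite /gap normr_le0 subr_eq0 => /eqP <-; rewrite -phiK; congr phi.
  by apply: hyperUidl => _ ->; rewrite KA; left.
apply: contrapT => nAB.
have : nbhs B [set T | phi (hyperU A T) <> phi A].
  have : (fun T => phi (hyperU A T)) @ B --> phi (hyperU A B).
    apply: cvg_phi.
    exact: (@cvg_hyperU _ _ _ (fun=> A) id _ _ (nbhs_filter B) (cvg_cst A)).
  have nb : nbhs (phi (hyperU A B)) (~` [set phi A]).
    apply: open_nbhs_nbhs; split=> //; apply: closed_openC.
    by apply: closed_point; exact: Rhausdorff.
  by move=> /(_ _ nb).
move=> /(finite_hyper_dense hX)[T [/= nT /finite_seqP[s Ts] TB]]; apply: nT.
have [|K [KA <-]] := fin s; first by move=> b bs; apply: TB; rewrite Ts.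
by congr phi; apply: hyper_eq; rewrite /= KA Ts.
Qed.

(** If [S'] missed the closed e-ball around [t], so would [D]-most [T' n], although [T n] has points
    within e/2 of [t] that [T' n] matches up to 1/(n+1). Countable compactness then brings the
    distance down to zero. *)
Lemma translation_dist_limit (D : set_system nat) (T T' : nat -> hyperspace X)
    (S S' : hyperspace X) :
  UltraFilter D -> (forall n, D [set m | (n <= m)%N]) ->
  T @ D --> S -> T' @ D --> S' ->
  (forall n t, hset (T n) t ->
    exists2 t', hset (T' n) t' & rho t t' < n.+1%:R^-1) ->
  forall t, hset S t -> exists2 t', hset S' t' & rho t t' <= 0.
Proof.
move=> UD Doo TS T'S' TT' t St; have FD : Filter D by exact: _.
have oball e : open [set s | rho t s < e].
  by apply: open_comp (@open_lt R e) => s _; exact: translation_dist_continuous.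
have oball' e : open [set s | e < rho t s].
  by apply: open_comp (@open_gt R e) => s _; exact: translation_dist_continuous.
have approx (e : R) : 0 < e -> exists2 t', hset S' t' & rho t t' <= e.
  move=> e0; apply: contrapT => h.
  have S'e : hset S' `<=` [set s | e < rho t s].
    by move=> s S's; rewrite /= ltNge; apply/negP => se; apply: h; exists s.
  have De := cvg_hyper_sub FD T'S' (oball' e) S'e.
  have Dt : D [set n | hset (T n) `&` [set s | rho t s < e / 2] !=set0].
    apply: (cvg_hyper_meet FD TS (oball _)); exists t; split=> //=.
    by apply: le_lt_trans (translation_distxx t) _; rewrite divr_gt0.
  have De2 : D [set n | n.+1%:R^-1 < e / 2].
    have [|N NP] := @natSinv_lt R (e / 2); first by rewrite divr_gt0.
    by apply: filterS (Doo N) => n; exact: NP.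
  have [n [[/= T'e [s [Ts ts]]] ne]] := filter_ex (filterI (filterI De Dt) De2).
  have [s' T's' ss'] := TT' _ _ Ts.
  have et' : e < rho t s' := T'e _ T's'.
  have ne' : n.+1%:R^-1 < e / 2 := ne.
  have ts' : rho t s < e / 2 := ts.
  have := lt_le_trans et' (translation_dist_triangle s t s').
  by have := lt_trans ss' ne'; lra.
pose Q n := hset S' `&` [set s | rho t s <= n.+1%:R^-1].
have [n|n|m n mn s [S's tsn]|t' Qt'] := @countably_compact_bigcap X Q cX.
- apply: closedI; first exact: hset_closed.
  rewrite [X in closed X](_ : _ = ~` [set s | n.+1%:R^-1 < rho t s]).
    exact/open_closedC.
  by apply/seteqP; split=> s /=; rewrite leNgt => /negP.
- by have [|t' S't' tt'] := approx n.+1%:R^-1; [rewrite invr_gt0|exists t'].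
- split=> //=; apply: le_trans tsn _.
  by rewrite lef_pV2 ?posrE // ler_nat.
exists t'; first by have [] := Qt' 0%N.
rewrite leNgt; apply/negP => e0.
have [N NP] := natSinv_lt e0.
by have [_ /=] := Qt' N; rewrite leNgt NP.
Qed.

(** Counterexamples for d = 1/(n+1) have ultrafilter limits [S] and [S'] that absorb each other, so
    phi(S) = phi(S u S') = phi(S'), while the gap [e] survives the limit. *)
Lemma translation_dist_uniform (e : R) : 0 < e -> exists2 d, 0 < d & forall T T',
  (forall t, hset T t -> exists2 t', hset T' t' & rho t t' < d) ->
  (forall t', hset T' t' -> exists2 t, hset T t & rho t t' < d) ->
  `|phi T - phi T'| <= e.
Proof.
move=> e0; apply: contrapT => h.
have pick n : exists P : hyperspace X * hyperspace X, [/\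
    forall t, hset P.1 t -> exists2 t', hset P.2 t' & rho t t' < n.+1%:R^-1,
    forall t', hset P.2 t' -> exists2 t, hset P.1 t & rho t t' < n.+1%:R^-1 &
    e < `|phi P.1 - phi P.2|].
  apply: contrapT => hn; apply: h; exists n.+1%:R^-1; first by rewrite invr_gt0.
  move=> T T' TT' T'T; rewrite leNgt; apply/negP => eT; apply: hn.
  by exists (T, T').
have [P PP] := choice pick.
have [D [UD Doo]] := eventually_ultrafilter.
have [S PS] := ultra_hyper_cvg bX (fun n => (P n).1).
have [S' PS'] := ultra_hyper_cvg bX (fun n => (P n).2).
have SS' : phi S = phi S'.
  rewrite -(@absorb_translation_dist0 S S') => [|b S'b].
    rewrite hyperUC; apply: absorb_translation_dist0 => b Sb.
    have [n t Pt|a S'a ab] := translation_dist_limit UD Doo PS PS' _ Sb.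
      by have [/(_ t Pt)] := PP n.
    by exists a => //; rewrite translation_distC.
  have [n t Pt|a Sa ab] := translation_dist_limit UD Doo PS' PS _ S'b.
    have [_ /(_ t Pt)[s Ps st] _] := PP n.
    by exists s => //; rewrite translation_distC.
  by exists a => //; rewrite translation_distC.
have : e <= `|phi S - phi S'|.
  have c : (fun n => `|phi (P n).1 - phi (P n).2|) @ D --> `|phi S - phi S'|.
    by apply: cvg_norm; apply: cvgB; exact: cvg_phi.
  apply: (ler_cvg_to (cvg_cst _) c).
  by apply: filterE => n; have [_ _ /ltW] := PP n.
by rewrite SS' subrr normr0 leNgt e0.
Qed.

(** Otherwise a greedy choice gives a d-separated sequence, yet two of its terms lie within d/2 of a
    cluster point. *)
Lemma translation_dist_totally_bounded (d : R) : 0 < d -> exists s : seq X,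
  forall x, exists2 a, a \in s & rho a x < d.
Proof.
move=> d0; apply: contrapT => h.
have pick (s : seq X) : exists x, forall a, a \in s -> d <= rho a x.
  apply: contrapT => hs; apply: h; exists s => x; apply: contrapT => hx.
  apply: hs; exists x => a sa; rewrite leNgt; apply/negP => ax.
  by apply: hx; exists a.
have [next nextP] := choice pick.
pose s k := iter k (fun s => next s :: s) [::].
have sep i k : (i < k)%N -> d <= rho (next (s i)) (next (s k)).
  move=> ik; apply: nextP; elim: k ik => // k IHk.
  rewrite ltnS leq_eqVlt => /predU1P[->|/IHk ik]; first exact: mem_head.
  by rewrite inE ik orbT.
have [y yP] := cX (fun k => next (s k)).
have yd : nbhs y [set z | rho y z < d / 2].
  apply: open_nbhs_nbhs; split.
    by apply: open_comp (@open_lt R _) => z _; exact: translation_dist_continuous.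
  by apply: le_lt_trans (translation_distxx y) _; rewrite divr_gt0.
have tail n : exists2 k, (n <= k)%N & rho y (next (s k)) < d / 2.
  have [|_ [[k /= nk <-] yk]] :=
      yP ((fun k => next (s k)) @` [set k | (n <= k)%N]) _ _ yd.
    by exists n => // k nk; exists k.
  by exists k.
have [i _ yi] := tail 0%N; have [k ik yk] := tail i.+1.
have := sep _ _ ik; have := translation_dist_triangle y (next (s i)) (next (s k)).
by rewrite (translation_distC _ y); lra.
Qed.

End translation_pseudometric.

(** * Extension to the compactification *)

Lemma filter_forall_seq (T : Type) (I : eqType) (F : set_system T) (s : seq I)
    (P : I -> set T) : Filter F ->
  (forall a, a \in s -> F (P a)) -> F [set z | forall a, a \in s -> P a z].
Proof.
move=> FF; elim: s => [|b s IHs] FP; first exact: filterE.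
have Fs : F [set z | forall a, a \in s -> P a z].
  by apply: IHs => a sa; apply: FP; rewrite inE sa orbT.
apply: filterS (filterI (FP b (mem_head _ _)) Fs) => z [Pb Ps] a.
by rewrite inE => /predU1P[->//|]; exact: Ps.
Qed.

Section trace.
Context {R : realType} {X : topologicalType}.
Local Notation bX := (stone_cech R X).
Local Notation iota := (@stone_cech_in R X).

Lemma hyper_closure_subproof (T : hyperspace X) : closure (iota @` hset T) !=set0.
Proof.
by have [x Tx] := hset_neq0 T; exists (iota x); apply: subset_closure; exists x.
Qed.

(** Through this map a neighbourhood [W] in the hyperspace of the compactification leaves its trace
    on that of [X]: the [T] with [W (hyper_closure T)]. *)
Definition hyper_closure (T : hyperspace X) : hyperspace bX :=
  Hyperspace (@closed_closure _ _) (hyper_closure_subproof T).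

Lemma hyper_closure_sub T x : hset T x -> hset (hyper_closure T) (iota x).
Proof. by move=> Tx; apply: subset_closure; exists x. Qed.

Lemma hyper_closure_meet T (V : set bX) : open V ->
  hset (hyper_closure T) `&` V !=set0 -> exists2 x, hset T x & V (iota x).
Proof.
move=> oV [z [Tz Vz]].
have [_ [[x Tx <-] Vx]] := Tz _ (open_nbhs_nbhs (conj oV Vz)).
by exists x.
Qed.

Lemma hyper_separation (S : hyperspace bX) (V : set bX) :
  open V -> hset S `<=` V ->
  exists2 C, open C & hset S `<=` C /\ closure C `<=` V.
Proof.
move=> oV SV.
have nbX := compact_normal (@stone_cech_hausdorff R X) (@stone_cech_compact R X).
have [|C] := nbX (hset S) (hset_closed (h := S)) V.
  by move=> z /SV Vz; exact: open_nbhs_nbhs.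
move=> SC CV; exists C°; first exact: open_interior.
split; first by move=> z Sz; exact: SC.
by apply: subset_trans CV; apply: closureS; exact: interior_subset.
Qed.

(** [T] is the part in [X] of [closure C], for an open [C] squeezed between [S] and [V]. By density
    of [X] its closure contains [S], so [hyper_upper_nbhs] applies. The second clause serves
    p-maximality. *)
Lemma hyper_closure_dense (S : hyperspace bX) W : nbhs S W ->
  exists2 T, W (hyper_closure T) & forall x, hset S (iota x) -> hset T x.
Proof.
move=> /hyper_upper_nbhs[V [oV SV VW]].
have [C oC [SC CV]] := hyper_separation oV SV.
have meetC z N : hset S z -> nbhs z N -> exists x, C (iota x) /\ N (iota x).
  move=> Sz; rewrite nbhsE => -[N' [oN' N'z] N'N].
  have CN : (C `&` N') !=set0 by exists z; split=> //; exact: SC.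
  have [y [[Cy N'y] [x _ xE]]] := stone_cech_in_dense CN (openI oC oN').
  by exists x; rewrite xE; split=> //; exact: N'N.
have cT : closed (iota @^-1` closure C).
  apply: preimage_closed; last exact: closed_closure.
  by move=> x _; exact: stone_cech_in_continuous.
have T0 : (iota @^-1` closure C) !=set0.
  have [z Sz] := hset_neq0 S; have [x [Cx _]] := meetC _ _ Sz filterT.
  by exists x; apply: subset_closure.
exists (Hyperspace cT T0); last by move=> x /SC; exact: subset_closure.
apply: VW => /=.
  move=> z Sz N zN; have [x [Cx Nx]] := meetC _ _ Sz zN.
  by exists (iota x); split=> //; exists x => //; exact: subset_closure.
apply: subset_trans CV; rewrite [X in _ `<=` X](_ : _ = closure (closure C)).
  by apply: closureS => _ [x Cx <-].
exact/closure_id/closed_closure.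
Qed.

End trace.

Section extension.
Context {R : realType} {X : topologicalType}.
Hypothesis hX : hausdorff_space X.
Hypothesis cX : countably_compact X.
Hypothesis omX : omega_bounded X.
Local Notation bX := (stone_cech R X).
Local Notation iota := (@stone_cech_in R X).

Lemma trace_cauchy (phi : hyperspace X -> R) (S : hyperspace bX) (e : R) :
  continuous phi -> (forall T, 0 <= phi T <= 1) -> 0 < e ->
  exists2 W, nbhs S W & forall T T', W (hyper_closure T) ->
    W (hyper_closure T') -> `|phi T - phi T'| <= e.
Proof.
move=> cphi phi01 e0.
pose rho := translation_dist hX phi.
have [d d0 dP] := translation_dist_uniform hX cX omX cphi phi01 e0.
have d2 : 0 < d / 2 by rewrite divr_gt0.
have d4 : 0 < d / 2 / 2 by rewrite divr_gt0.
have [s sP] := translation_dist_totally_bounded hX cX omX cphi phi01 d4.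
have rho1 a x : `|rho a x| <= 1 by exact: translation_dist_norm_le1.
have ext a : exists h : bX -> R, continuous h /\ forall x, h (iota x) = rho a x.
  have [|h ch hE] := stone_cech_extension _ (rho1 a); last by exists h.
  exact: translation_dist_continuous.
have [h hP] := choice ext.
pose V a := [set z | h a z < d / 2].
have oV a : open (V a).
  by apply: open_comp (@open_lt R _) => z _; have [ch _] := hP a; exact: ch.
(* At a point outside every [V a] all [h a] are at least d/2, hence above d/4 at nearby points of
   [X], against the choice of the d/4-net [s]. *)
have coverV z : exists2 a, a \in s & V a z.
  apply: contrapT => nV.
  have : nbhs z [set w | forall a, a \in s -> [set w | d / 2 / 2 < h a w] w].
    apply: filter_forall_seq => a sa; apply: open_nbhs_nbhs; split.
      by apply: open_comp (@open_gt R _) => w _; have [ch _] := hP a; exact: ch.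
    apply: (@lt_le_trans _ _ (d / 2)); first by lra.
    by rewrite leNgt; apply/negP => za; apply: nV; exists a.
  rewrite nbhsE => -[U [oU Uz] Us].
  have [y [Uy [x _ xE]]] := stone_cech_in_dense (ex_intro _ z Uz) oU.
  have [a sa ax] := sP x; have := Us _ Uy a sa.
  by rewrite -xE /= (hP a).2 ltNge (ltW ax).
(* Sets in the neighbourhood chosen here lie in the union of the [V a] that meet [S], and meet each
   of these. Points of two traces are thus matched through a common centre [a], at distance below
   d/2 + d/2. *)
pose U := \bigcup_(a in [set a | a \in s /\ hset S `&` V a !=set0]) V a.
exists ([set T | hset T `<=` U] `&` [set T | forall a, a \in s ->
    [set T | hset S `&` V a !=set0 -> hset T `&` V a !=set0] T]).
  apply: filterI.
    apply: open_nbhs_nbhs; split.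
      by apply: open_hyper_sub; exact: bigcup_open.
    move=> z Sz; have [a sa Vz] := coverV z; exists a => //.
    by split=> //; exists z.
  apply: filter_forall_seq => a sa.
  have [Sa|nSa] := pselect (hset S `&` V a !=set0); last first.
    by apply: filterE => T /nSa.
  have : nbhs S [set T | hset T `&` V a !=set0].
    by apply: open_nbhs_nbhs; split=> //; exact: open_hyper_meet.
  by apply: filterS => T TV _.
have half T T' : hset (hyper_closure T) `<=` U ->
    (forall a, a \in s -> hset S `&` V a !=set0 ->
      hset (hyper_closure T') `&` V a !=set0) ->
    forall t, hset T t -> exists2 t', hset T' t' & rho t t' < d.
  move=> TU T'V t Tt; have [a [sa Sa] Vt] := TU _ (hyper_closure_sub Tt).
  have [t' T't' Vt'] := hyper_closure_meet (oV a) (T'V a sa Sa).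
  exists t' => //; apply: le_lt_trans (translation_dist_triangle hX phi01 a t t') _.
  move: Vt Vt'; rewrite /V /= !(hP a).2 => at1 at2.
  rewrite (translation_distC hX phi t a); rewrite -/rho; lra.
move=> T T' [TU TV] [T'U T'V]; apply: dP; first exact: half.
move=> t' T't'; have [t Tt tt'] := half _ _ T'U TV _ T't'.
by exists t => //; rewrite translation_distC.
Qed.

(** [F S] is a cluster point, given by compactness, of the values of [f] on the traces of
    neighbourhoods of [S]; [trace_cauchy], applied to each coordinate [g], makes it their limit. *)
Lemma selection_extension (f : hyperspace X -> X) : continuous_selection f ->
  exists F : hyperspace bX -> bX, continuous_selection F /\
    forall p, (forall T, hset T p -> f T = p) ->
      forall S, hset S (iota p) -> F S = iota p.
Proof.
move=> [cf sf].
pose phi (g : cube_index R X) T := set_val g (f T).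
have cphi g : continuous (phi g).
  move=> T; have [cg _] := cube_indexP g.
  exact: cvg_comp (@cf T) (@cg (f T)).
have phi01 g T : 0 <= phi g T <= 1.
  have [_ g01] := cube_indexP g.
  have /g01 : range (set_val g) (phi g T) by exists (f T).
  by rewrite /= in_itv.
have limit (S : hyperspace bX) : exists z : bX,
    (forall W : set (hyperspace bX), nbhs S W ->
      closure [set iota (f T) | T in [set T | W (hyper_closure T)]] z) /\
    (forall g (e : R), 0 < e -> exists2 W, nbhs S W & forall T,
      W (hyper_closure T) -> `|phi g T - (set_val z : _ -> R) g| <= e).
  pose im (W : set (hyperspace bX)) :=
    [set iota (f T) | T in [set T | W (hyper_closure T)]].
  have FF : ProperFilter (filter_from (nbhs S) im).
    apply: filter_from_proper; last first.
      by move=> W /hyper_closure_dense[T WT _]; exists (iota (f T)), T.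
    apply: filter_from_filter; first by exists setT; exact: filterT.
    move=> W W' SW SW'; exists (W `&` W'); first exact: filterI.
    by move=> _ [T [WT W'T] <-]; split; exists T.
  have [z [_ zF]] := @stone_cech_compact R X _ FF filterT.
  have zim W : nbhs S W -> closure (im W) z.
    by move=> SW N zN; apply: zF zN; exists W.
  exists z; split=> // g e e0.
  have e2 : 0 < e / 2 by rewrite divr_gt0.
  have [W SW WP] := trace_cauchy S (cphi g) (phi01 g) e2.
  exists W => // T WT.
  have zg : nbhs z [set w |
      `|(set_val z : _ -> R) g - (set_val w : _ -> R) g| <= e / 2].
    have /cvgrPdist_le := @cube_proj_continuous R X g z.
    exact.
  have [_ [[T' WT' <-] /= zT']] := zim _ SW _ zg.
  have := WP _ _ WT WT'.
  have -> : phi g T - (set_val z : _ -> R) g =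
      (phi g T - phi g T') - ((set_val z : _ -> R) g - phi g T') by ring.
  move=> h; apply: le_trans (ler_normB _ _) _.
  rewrite [leRHS]splitr lerD //.
have [F FP] := choice limit.
have Fcont : continuous F.
  apply: (@continuous_comp_initial bX _ _ set_val).
  move=> S; have FS : Filter ((set_val \o F) @ S).
    by apply: fmap_filter; exact: nbhs_filter.
  apply/cvg_sup => g; move: {FS} S.
  apply: (@continuous_comp_initial (prod_topology (fun _ : cube_index R X => R)) _ R
    (fun u => u g)) => S.
  have FS := nbhs_filter S; apply/cvgrPdist_le => e e0.
  have e2 : 0 < e / 2 by rewrite divr_gt0.
  have [W SW WP] := (FP S).2 g _ e2.
  move: SW; rewrite nbhsE => -[O [oO OS] OW].
  have SO : nbhs S O by exact: open_nbhs_nbhs.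
  apply: (@filterS _ _ FS O) => [S' OS'|]; last exact: SO.
  have [W' S'W' W'P] := (FP S').2 g _ e2.
  (* A single [T] whose closure is near both [S] and [S'] compares [F S] with [F S']. *)
  have [T [OT W'T] _] := hyper_closure_dense
    (filterI (open_nbhs_nbhs (conj oO OS')) S'W').
  rewrite /= [leRHS]splitr; apply: le_trans (ler_distD (phi g T) _ _) _.
  by rewrite lerD ?(W'P _ W'T) // distrC; exact/WP/OW.
exists F; split.
  split=> // S; apply: contrapT => nS.
  have oS : open (~` [set F S]).
    apply: closed_openC; apply: closed_point; exact: stone_cech_hausdorff.
  (* For [T] with closure inside [C], the value [f T] lies in [C]; so [F S] is in [closure C], which
     was chosen to miss it. *)
  have [|C oC [SC CF]] := hyper_separation oS (S := S).
    by move=> z Sz /= zF; apply: nS; rewrite -zF.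
  apply: (CF (F S)) => //.
  have := (FP S).1 _ (open_nbhs_nbhs (conj (open_hyper_sub oC) SC)).
  apply: closureS => _ [T TC <-]; apply: TC.
  exact: hyper_closure_sub.
move=> p fp S Sp; apply: val_inj; apply/funext => g.
apply/eqP; rewrite -subr_eq0 -normr_le0 leNgt; apply/negP => e0.
(* Some [T] through [p] has closure near [S], and f(T) = p, so the supposed nonzero difference is at
   most half of itself. *)
have e2 : 0 < `|(set_val (F S) : _ -> R) g - set_val g p| / 2.
  by rewrite divr_gt0.
have [W SW WP] := (FP S).2 g _ e2.
have [T WT ST] := hyper_closure_dense SW.
have := WP _ WT; rewrite /phi fp; last exact: ST.
by rewrite distrC leNgt ltr_pdivrMr // ltr_pMr // ltr1n.
Qed.

End extension.

Theorem theorem6p2 (R : realType) (X : topologicalType)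
    (pcX : pseudocompact R X) (spmX : selection_pointwise_maximal X) :
  forall p : X,
    exists f : hyperspace (stone_cech R X) -> stone_cech R X,
      maximal_selection (stone_cech_in R p) f.
Proof.
move=> p; have [[hX crX] _] := pcX.
have rX := @completely_regular_regular R X crX.
have [f [csf fp]] := spmX p.
have cX : countably_compact X.
  apply: selection_pointwise_maximal_countably_compact => //.
  exact: pseudocompact_feebly_compact pcX.
have omX := weak_order_omega_bounded cX (weak_order_selection hX csf).
have [F [csF FP]] := @selection_extension R X hX cX omX f csf.
by exists F; split=> //; exact: FP fp.
Qed.
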